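(* For any rich computable Polish space $\mathcal{X}$ which is computably non-$K_\sigma$, $\mathsf{CB}_{\mathbb{N}^{\mathbb{N}}}\le_{\mathrm{W}}\mathsf{CB}_{\mathcal{X}}$.
   Context: A represented space is a set $X$ with a partial surjection $\delta_X:\subseteq\mathbb{N}^{\mathbb{N}}\to X$; $p$ is a name of $x$ if $\delta_X(p)=x$. A (multi-valued) function between represented spaces is computable if there is a computable partial map on $\mathbb{N}^{\mathbb{N}}$ sending each name of a point of the domain to a name of a value. A problem is a partial multi-valued function $f:\subseteq X\rightrightarrows Y$ between represented spaces. $f\le_{\mathrm{W}} g$ (Weihrauch reducibility) means that there are computable partial maps $\Phi,\Psi:\subseteq\mathbb{N}^{\mathbb{N}}\to\mathbb{N}^{\mathbb{N}}$ such that for every name $p$ of some $x\in\mathrm{dom}(f)$, $\Phi(p)$ is a name of some $y\in\mathrm{dom}(g)$, and for every name $q$ of an element of $g(y)$, $\Psi(p*q)$ is a name of an element of $f(x)$, where $p*q$ is the interleaving of $p$ and $q$. A computable metric space $\mathcal{X}=(X,d,\alpha)$ is a separable metric space with a dense sequence $\alpha:\mathbb{N}\to X$ such that $(i,j)\mapsto d(\alpha(i),\alpha(j))$ is a computable double sequence of reals. It is represented by the Cauchy representation: $p$ is a name of $\lim_n\alpha(p(n))$ whenever $d(\alpha(p(i)),\alpha(p(j)))<2^{-j}$ for all $i>j$ and the limit exists in $X$. It is a computable Polish space if $d$ is complete. $(q_m)$ is a fixed computable enumeration of $\mathbb{Q}$ and $B_{\langle n,m\rangle}=\{x:d(x,\alpha(n))<q_m\}$.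 $\mathcal{A}(\mathcal{X})$ is the space of closed subsets of $X$ with the negative representation: $p$ is a name of $X\setminus\bigcup_iB_{p(i)}$; $\Pi^0_1(\mathcal{X})$ is the collection of closed sets having a computable name. For Baire space the negative representation is equivalent to naming $C$ by a tree $T\subseteq\mathbb{N}^{<\mathbb{N}}$ whose set of infinite paths is $C$. Products and sequence spaces carry the standard representations. A computable embedding $\iota:\mathcal{Y}\to\mathcal{X}$ is an injective computable map whose partial inverse is also computable. $\mathcal{X}$ is rich if there is a computable embedding of $2^{\mathbb{N}}$ into $\mathcal{X}$. A computable Polish space $\mathcal{X}$ is computably non-$K_\sigma$ if there is a computable embedding $\iota:\mathbb{N}^{\mathbb{N}}\to\mathcal{X}$ with $\mathrm{range}(\iota)\in\Pi^0_1(\mathcal{X})$. A closed set is perfect if it has no isolated points; the perfect kernel $\mathsf{PK}_{\mathcal{X}}(A)$ of a closed set $A$ in a Polish space is the unique perfect $P\subseteq A$ with $A\setminus P$ countable. $\mathsf{CB}_{\mathcal{X}}:\mathcal{A}(\mathcal{X})\rightrightarrows\mathcal{A}(\mathcal{X})\times(\mathbb{N}\times(2\times\mathcal{X})^{\mathbb{N}})$ maps every closed set $A$ to the set of all $(\mathsf{PK}_{\mathcal{X}}(A),(n,(b_i,x_i)_{i\in\mathbb{N}}))$ with $A\setminus\mathsf{PK}_{\mathcal{X}}(A)=\{x_i:b_i=1\}$ and $n=0$ if $A\setminus\mathsf{PK}_{\mathcal{X}}(A)$ is infinite, $n=|A\setminus\mathsf{PK}_{\mathcal{X}}(A)|+1$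 if it is finite. *)

(* Defs.v *)
From HB Require Import structures.
From Stdlib Require Cantor.
From mathcomp Require Import all_boot all_order all_algebra.
From mathcomp Require Import all_classical all_reals all_analysis.
From mathcomp Require Import lra zify.

Set Implicit Arguments.
Unset Strict Implicit.
Unset Printing Implicit Defensive.

Import Order.TTheory GRing.Theory Num.Theory.

Local Open Scope classical_set_scope.
Local Open Scope ring_scope.

(** * Computability on Baire space *)

Definition bseq := nat -> nat.

Definition npair (m n : nat) : nat := Cantor.to_nat (m, n).
Definition nunpair (n : nat) : nat * nat := Cantor.of_nat n.

Lemma npairK m n : nunpair (npair m n) = (m, n).
Proof. exact: Cantor.cancel_of_to. Qed.

Lemma nunpairK n : npair (nunpair n).1 (nunpair n).2 = n.
Proof. by rewrite /npair -surjective_pairing; exact: Cantor.cancel_to_of. Qed.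

(** Kleene's partial recursive functions relative to an oracle, presented as
    unary functions: several arguments are passed through [npair]. *)
Inductive code : Set :=
| Zero | Succ | Fst | Snd | Oracle
| Pair of code & code
| Comp of code & code
| Prec of code & code
| Mu of code.

(** [eval p c x y]: with oracle [p], the program [c] halts on input [x] with
    output [y].  [Prec a b] is the function h with h<u,0> = a(u) and
    h<u,i+1> = b<u,<i,h<u,i>>>, where [s] below lists the values h<u,0>, h<u,1>,
    ...; [Mu a] maps x to the least y with a<x,y> = 0, all the earlier values
    being defined. *)
Fixpoint eval (p : bseq) (c : code) (x y : nat) : Prop :=
  match c with
  | Zero => y = 0%N
  | Succ => y = x.+1
  | Fst => y = (nunpair x).1
  | Snd => y = (nunpair x).2
  | Oracle => y = p x
  | Pair a b => exists u v, [/\ eval p a x u, eval p b x v & y = npair u v]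
  | Comp a b => exists2 u, eval p b x u & eval p a u y
  | Prec a b => let: (u, n) := nunpair x in
      exists s : nat -> nat,
        [/\ eval p a u (s 0%N),
            forall i, (i < n)%N -> eval p b (npair u (npair i (s i))) (s i.+1)
          & y = s n]
  | Mu a => eval p a (npair x y) 0%N /\
      forall z, (z < y)%N -> exists v, eval p a (npair x z) v.+1
  end.

Lemma eval_fun p c x y y' : eval p c x y -> eval p c x y' -> y = y'.
Proof.
elim: c x y y' => [|||||a iha b ihb|a iha b ihb|a iha b ihb|a iha] x y y' /=;
  do ?[by move=> -> ->].
- by move=> [u [v [au bv ->]]] [u' [v' [au' bv' ->]]];
    rewrite (iha _ _ _ au au') (ihb _ _ _ bv bv').
- by move=> [u bu au] [u' bu']; rewrite -(ihb _ _ _ bu bu'); exact: iha au.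
- case: (nunpair x) => u n [s [as0 bs ->]] [s' [as0' bs' ->]].
  suff H i : (i <= n)%N -> s i = s' i by exact: H.
  elim: i => [_|i ih lin]; first exact: iha as0 as0'.
  apply: ihb (bs i lin) _; rewrite (ih (ltnW lin)); exact: bs'.
- move=> [a0 lt0] [a0' lt0']; case: (ltngtP y y') => // lt.
    by have [v av] := lt0' _ lt; have := iha _ _ _ av a0.
  by have [v av] := lt0 _ lt; have := iha _ _ _ av a0'.
Qed.

(** Every program [c] denotes the partial map of Baire space [p |-> q] below,
    defined at the [p] for which [c] with oracle [p] is total. The computable
    partial maps are the restrictions of the maps so denoted. *)
Definition computes (c : code) (p q : bseq) : Prop :=
  forall n, eval p c n (q n).

Definition computable_seq (p : bseq) : Prop :=
  exists c, computes c (fun=> 0%N) p.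

Definition join (p q : bseq) : bseq :=
  fun n => if odd n then q n./2 else p n./2.
Definition evens (p : bseq) : bseq := fun n => p n.*2.
Definition odds (p : bseq) : bseq := fun n => p n.*2.+1.

Lemma evens_join p q : evens (join p q) = p.
Proof. by apply/funext => n; rewrite /evens /join odd_double doubleK. Qed.

Lemma odds_join p q : odds (join p q) = q.
Proof.
by apply/funext => n; rewrite /odds /join /= odd_double /= uphalf_double.
Qed.

(** * Represented spaces and problems *)

Record repSpace := RepSpace {
  rcar :> Type;
  rname : bseq -> rcar -> Prop;
  rname_fun : forall p x y, rname p x -> rname p y -> x = y;
  rname_surj : forall x, exists p, rname p x }.

(** A partial multi-valued function; its domain is [[set x | f x !=set0]]. *)
Definition problem (X Y : repSpace) := X -> set Y.

Definition computable_problem (X Y : repSpace) (f : problem X Y) : Prop :=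
  exists c, forall p x, rname p x -> f x !=set0 ->
    exists q y, [/\ computes c p q, rname q y & f x y].

Definition weihrauch_le (X Y Z W : repSpace)
    (f : problem X Y) (g : problem Z W) : Prop :=
  exists Phi Psi : code, forall p x, rname p x -> f x !=set0 ->
    exists p' z, [/\ computes Phi p p', rname p' z, g z !=set0 &
      forall q w, g z w -> rname q w ->
        exists q' y, [/\ computes Psi (join p q) q', rname q' y & f x y]].

Definition computable_embedding (Y X : repSpace) (iota : Y -> X) : Prop :=
  [/\ injective iota,
      computable_problem (fun y => [set iota y]) &
      computable_problem (fun x => [set y | iota y = x])].

Definition nat_name (p : bseq) (n : nat) : Prop := p 0%N = n.

Lemma nat_name_fun p m n : nat_name p m -> nat_name p n -> m = n.
Proof. by move=> <-. Qed.

Lemma nat_name_surj n : exists p, nat_name p n.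
Proof. by exists (fun=> n). Qed.

Definition nat_rep : repSpace := RepSpace nat_name_fun nat_name_surj.

Definition bool_name (p : bseq) (b : bool) : Prop := p 0%N = b.

Lemma bool_name_fun p b c : bool_name p b -> bool_name p c -> b = c.
Proof. by rewrite /bool_name => -> ; case: b; case: c. Qed.

Lemma bool_name_surj b : exists p, bool_name p b.
Proof. by exists (fun=> nat_of_bool b). Qed.

Definition bool_rep : repSpace := RepSpace bool_name_fun bool_name_surj.

Section ProdSeq.
Variables X Y : repSpace.

Definition prod_name (p : bseq) (xy : X * Y) : Prop :=
  rname (evens p) xy.1 /\ rname (odds p) xy.2.

Lemma prod_name_fun p xy xy' : prod_name p xy -> prod_name p xy' -> xy = xy'.
Proof.
case: xy xy' => [x y] [x' y'] [/= px py] [/= px' py'].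
by rewrite (rname_fun px px') (rname_fun py py').
Qed.

Lemma prod_name_surj xy : exists p, prod_name p xy.
Proof.
have [p px] := rname_surj xy.1; have [q qy] := rname_surj xy.2.
by exists (join p q); rewrite /prod_name evens_join odds_join.
Qed.

Definition prod_rep : repSpace := RepSpace prod_name_fun prod_name_surj.

Definition seq_name (p : bseq) (x : nat -> X) : Prop :=
  forall i, rname (fun k => p (npair i k)) (x i).

Lemma seq_name_fun p x y : seq_name p x -> seq_name p y -> x = y.
Proof. by move=> px py; apply/funext => i; exact: rname_fun (px i) (py i). Qed.

Lemma seq_name_surj x : exists p, seq_name p x.
Proof.
have /choice [p px] := fun i => rname_surj (x i).
exists (fun n => p (nunpair n).1 (nunpair n).2) => i.
suff -> : (fun k => p (nunpair (npair i k)).1 (nunpair (npair i k)).2) = p i.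
  exact: px.
by apply/funext => k; rewrite npairK.
Qed.

Definition seq_rep : repSpace := RepSpace seq_name_fun seq_name_surj.

End ProdSeq.

(** * Computable metric spaces *)

(** q_<<s,t>,b> = (s - t) / (b + 1). *)
Definition qenum (m : nat) : rat :=
  let: (a, b) := nunpair m in
  let: (s, t) := nunpair a in (s%:R - t%:R) / b.+1%:R.

Lemma qenum_surj (r : rat) : exists m, qenum m = r.
Proof.
have [b bE] : exists b : nat, denq r = b.+1%:Z.
  by case: (denq r) (denq_gt0 r) => [[|b]|b] // _; exists b.
have [s [t stE]] : exists s t : nat, numq r = s%:Z - t%:Z.
  by case: (numq r) => n; [exists n, 0%N|exists 0%N, n.+1]; lia.
exists (npair (npair s t) b); rewrite /qenum !npairK.
rewrite -[RHS]divq_num_den bE stE rmorphB/=.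
by rewrite !pmulrn.
Qed.

Record sepMetric (R : realType) := SepMetric {
  scar :> metricType R;
  spt : nat -> scar;
  spt_dense : dense (range spt) }.

Section SepMetric.
Context {R : realType} (X : sepMetric R).

Definition computable_metric : Prop :=
  exists f : bseq, computable_seq f /\ forall i j k,
    `|mdist (spt X i) (spt X j) - ratr (qenum (f (npair i (npair j k))))|
      < 2^-1 ^+ k.

Definition complete_metric : Prop :=
  forall u : nat -> X, cauchy (u @ \oo) -> exists x : X, u @ \oo --> x.

Definition computable_Polish : Prop := computable_metric /\ complete_metric.

Definition cauchy_name (p : bseq) (x : X) : Prop :=
  (forall i j, (j < i)%N ->
     mdist (spt X (p i)) (spt X (p j)) < 2^-1 ^+ j) /\
  (fun n => spt X (p n)) @ \oo --> x.

Lemma cauchy_name_fun p x y : cauchy_name p x -> cauchy_name p y -> x = y.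
Proof.
move=> [_ px] [_ py]; apply: mdist_positivity; apply/eqP.
rewrite eq_le mdist_ge0 andbT; apply/ler_addgt0Pl => e e0; rewrite addr0.
have e2 : 0 < e / 2 by rewrite divr_gt0.
have xe : \forall n \near \oo, mdist x (spt X (p n)) < e / 2.
  by move/metricType_numDomainType.cvgrPdist_lt : px; exact.
have ye : \forall n \near \oo, mdist y (spt X (p n)) < e / 2.
  by move/metricType_numDomainType.cvgrPdist_lt : py; exact.
have [n [xn yn]] := filter_ex (filterI xe ye).
apply: le_trans (metric_triangle _ (spt X (p n)) _) _.
by rewrite (metric_sym _ y) (splitr e) ltW// ltrD.
Qed.

Lemma spt_near (x : X) (e : R) : 0 < e -> exists n, mdist x (spt X n) < e.
Proof.
move=> e0; have B0 : (ball x e)° !=set0 by exists x; exact: nbhsx_ballx.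
have [y [By [n _ ny]]] := @spt_dense _ X _ B0 (open_interior _).
by exists n; rewrite ny; have := interior_subset By; rewrite ballEmdist.
Qed.

Lemma cauchy_name_surj x : exists p, cauchy_name p x.
Proof.
have pos n : 0 < (2^-1 ^+ n : R) by rewrite exprn_gt0// invr_gt0.
have /choice [p px] := fun n => spt_near x (pos n.+2).
exists p; split=> [i j ji|].
  apply: le_lt_trans (metric_triangle _ x _) _; rewrite metric_sym.
  have : (2^-1 ^+ i.+2 : R) <= 2^-1 ^+ j.+2.
    by rewrite ler_wiXn2l ?invr_ge0// ?invf_le1 ?ler1n//; lia.
  have := px i; have := px j; have := pos j; rewrite !exprS; lra.
apply/metricType_numDomainType.cvgrPdist_lt => e e0.
have : (2^-1 ^+ n : R) @[n --> \oo] --> 0.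
  by apply: cvg_expr; rewrite ger0_norm ?invr_ge0// invf_lt1 ?ltr1n.
move=> /cvgr_lt /(_ e e0); apply: filterS => n ne.
apply: lt_trans (px n) _; apply: le_lt_trans ne; rewrite !exprS.
by have := pos n; lra.
Qed.

Definition cauchy_rep : repSpace :=
  @RepSpace X cauchy_name cauchy_name_fun cauchy_name_surj.

Definition rball (i : nat) : set X :=
  let: (n, m) := nunpair i in [set x | mdist x (spt X n) < ratr (qenum m)].

Definition neg_name (p : bseq) (A : set X) : Prop :=
  A = ~` \bigcup_i rball (p i).

Lemma neg_name_surj (A : set X) : closed A -> exists p, neg_name p A.
Proof.
move=> cA; have [z zE] := qenum_surj 0.
pose p i := if `[< rball i `<=` ~` A >] then i else npair 0 z.
exists p; apply/seteqP; split=> x /=.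
  move=> Ax [i _]; rewrite /p; case: asboolP => [sub /sub//|_].
  by rewrite /rball npairK zE /= rmorph0 ltNge mdist_ge0.
move=> xN; apply: contrapT => Ax; apply: xN.
have /nbhs_ballP [e /= e0 eA] : nbhs x (~` A).
  by apply: open_nbhs_nbhs; split=> //; exact: closed_openC.
have e2 : 0 < e / 2 by lra.
have [n xn] := spt_near x e2.
have /rat_in_itvoo [r] := xn; rewrite in_itv /= => /andP[xr re].
have [m mE] := qenum_surj r.
exists (npair n m) => //; rewrite /p; case: asboolP => [_|].
  by rewrite /rball npairK /= mE.
case=> y; rewrite /rball npairK /= mE => yn; apply: eA; rewrite ballEmdist /=.
apply: le_lt_trans (metric_triangle _ (spt X n) _) _.
rewrite (metric_sym _ y); lra.
Qed.

Definition closed_name (p : bseq) (A : {A : set X | closed A}) : Prop :=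
  neg_name p (sval A).

Lemma closed_name_fun p A B : closed_name p A -> closed_name p B -> A = B.
Proof.
case: A B => [A cA] [B cB]; rewrite /closed_name /neg_name /= => AE BE.
by apply: eq_exist => /=; rewrite AE BE.
Qed.

Lemma closed_name_surj A : exists p, closed_name p A.
Proof. by case: A => A cA; exact: neg_name_surj. Qed.

Definition closed_rep : repSpace := RepSpace closed_name_fun closed_name_surj.

Definition Pi01 (A : set X) : Prop :=
  exists p, computable_seq p /\ neg_name p A.

Definition perfect_kernel (A P : set X) : Prop :=
  [/\ perfect_set P, P `<=` A & countable (A `\` P)].

Definition CB : problem closed_rep
    (prod_rep closed_rep
      (prod_rep nat_rep (seq_rep (prod_rep bool_rep cauchy_rep)))) :=
  fun A => [set y | let: (P, (n, bx)) := y in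
    let D := sval A `\` sval P in
    [/\ perfect_kernel (sval A) (sval P),
        D = [set x | exists i, bx i = (true, x)] &
        (infinite_set D /\ n = 0%N) \/
        (exists k : nat, (D #= `I_k)%card /\ n = k.+1)]].

End SepMetric.

Arguments CB {R} X A : rename.

(** * Sequence spaces *)

Definition seqspace (R : realType) (T : Type) := nat -> T.

Section SeqSpace.
Context (R : realType) (T : eqType).
Local Notation S := (seqspace R T).

HB.instance Definition _ := gen_eqMixin S.
HB.instance Definition _ := gen_choiceMixin S.

(** 2^-n for the least n with x n <> y n, and 0 if there is none *)
Definition seqdist (x y : S) : R :=
  if pselect (exists n, x n != y n) is left h then 2^-1 ^+ ex_minn h else 0.

Let pos n : 0 < (2^-1 ^+ n : R). Proof. by rewrite exprn_gt0// invr_gt0. Qed.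

Lemma seqdist_le x y n :
  (seqdist x y <= 2^-1 ^+ n) <-> (forall k, (k < n)%N -> x k = y k).
Proof.
rewrite /seqdist; case: pselect => [h|h].
  case: ex_minnP => m xym min_m.
  rewrite ler_iXn2l ?invr_gt0// ?invf_lt1 ?ltr1n//; split=> [nm k kn|H].
    by apply/eqP; apply: contraT => /min_m; lia.
  by rewrite leqNgt; apply/negP => /H /eqP; exact/negP.
split=> [_ k _|_]; last exact: ltW.
by apply/eqP; apply: contraT => xy; case: h; exists k.
Qed.

Lemma seqdist_dyadic x y :
  seqdist x y = 0 \/ exists n, seqdist x y = 2^-1 ^+ n.
Proof. by rewrite /seqdist; case: pselect => ?; [right; eexists|left]. Qed.

Lemma seqdist_ge0 x y : 0 <= seqdist x y.
Proof. by have [->//|[n ->]] := seqdist_dyadic x y; exact: ltW. Qed.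

Lemma seqdistxx x : seqdist x x = 0.
Proof. by rewrite /seqdist; case: pselect => // h; have [n /eqP] := h. Qed.

Lemma seqdist_eq0 x y : seqdist x y = 0 -> x = y.
Proof.
move=> xy; apply/funext => k; have /seqdist_le : seqdist x y <= 2^-1 ^+ k.+1.
  by rewrite xy; exact: ltW.
exact.
Qed.

Lemma seqdist_sym x y : seqdist x y = seqdist y x.
Proof.
wlog suff H : x y / seqdist x y <= seqdist y x.
  by apply/eqP; rewrite eq_le !H.
have [yx|[n yx]] := seqdist_dyadic y x; first by rewrite (seqdist_eq0 yx).
have /seqdist_le yxn : seqdist y x <= 2^-1 ^+ n by rewrite yx.
by rewrite yx; apply/seqdist_le => k kn; rewrite yxn.
Qed.

Lemma seqdist_triangle y x z : seqdist x z <= seqdist x y + seqdist y z.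
Proof.
have [xy|[n xy]] := seqdist_dyadic x y.
  by rewrite (seqdist_eq0 xy) seqdistxx add0r.
have [yz|[m yz]] := seqdist_dyadic y z.
  by rewrite (seqdist_eq0 yz) seqdistxx addr0.
have /seqdist_le xyn : seqdist x y <= 2^-1 ^+ n by rewrite xy.
have /seqdist_le yzm : seqdist y z <= 2^-1 ^+ m by rewrite yz.
have : seqdist x z <= 2^-1 ^+ minn n m.
  apply/seqdist_le => k; rewrite ltn_min => /andP[kn km].
  by rewrite xyn// yzm.
move=> /le_trans; apply; rewrite xy yz.
by have := pos n; have := pos m; case: leqP => _; lra.
Qed.

HB.instance Definition _ := @isMetric.Build R S seqdist
  seqdistxx seqdist_eq0 seqdist_sym seqdist_triangle.

End SeqSpace.

(** [finseq n] is the eventually zero sequence coded by [n]: 0 codes the zero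
    sequence and <a,c> + 1 the sequence with head a and tail coded by c. *)
Fixpoint finseq (n k : nat) : nat :=
  if n is m.+1 then
    if k is l.+1 then finseq (nunpair m).2 l else (nunpair m).1
  else 0%N.

Lemma finseq_dense (x : nat -> nat) n :
  exists c, forall k, (k < n)%N -> finseq c k = x k.
Proof.
elim: n x => [|n ih] x; first by exists 0%N.
have [c cE] := ih (fun k => x k.+1).
by exists (npair (x 0%N) c).+1 => -[|k] kn /=; rewrite npairK//= cE.
Qed.

Definition seqpt (R : realType) (T : eqType) (f : nat -> T) (n : nat) :
  seqspace R T := fun k => f (finseq n k).

Lemma seqpt_dense (R : realType) (T : eqType) (f : nat -> T) (g : T -> nat) :
  cancel g f -> dense (range (@seqpt R T f)).
Proof.
move=> gK O [x Ox] oO.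
have /nbhs_ballP [e /= e0 eO] : nbhs x O by exact: open_nbhs_nbhs.
have : (2^-1 ^+ n : R) @[n --> \oo] --> 0.
  by apply: cvg_expr; rewrite ger0_norm ?invr_ge0// invf_lt1 ?ltr1n.
move=> /cvgr_lt /(_ e e0) [n _ /(_ n (leqnn n)) /= ne].
have [c cE] := finseq_dense (g \o x) n.
exists (seqpt R f c); split; last by exists c.
apply: eO; rewrite ballEmdist /=; apply: le_lt_trans ne.
by apply/seqdist_le => k kn; rewrite /seqpt cE//= gK.
Qed.

Definition baire (R : realType) : sepMetric R :=
  SepMetric (@seqpt_dense R nat id id (fun=> erefl)).

Definition cantor (R : realType) : sepMetric R :=
  SepMetric (@seqpt_dense R bool odd nat_of_bool oddb).

(** * Rich and computably non-K_sigma spaces *)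

Definition rich (R : realType) (X : sepMetric R) : Prop :=
  exists iota : cauchy_rep (cantor R) -> cauchy_rep X,
    computable_embedding iota.

Definition computably_non_Ksigma (R : realType) (X : sepMetric R) : Prop :=
  exists iota : cauchy_rep (baire R) -> cauchy_rep X,
    computable_embedding iota /\ Pi01 (range iota).

(* Main.v *)
From Pilot Require Import Defs.
From mathcomp Require Import all_boot all_order all_algebra.
From mathcomp Require Import all_classical all_reals all_analysis.
From mathcomp Require Import lra zify.
Import Pilot.Defs.

Set Implicit Arguments.
Unset Strict Implicit.
Unset Printing Implicit Defensive.

Import Order.TTheory GRing.Theory Num.Theory.

(** Let iota be the closed embedding of Baire space into X. A computable map is
    effectively continuous: a ball of its domain is enumerated once a finite run
    of its program, valid for names of all the points of the ball, places the
    image in the complement of a closed set. Applied to the inverse of iota, this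
    yields a name of iota(A) from a name of A; applied to iota, it pulls the
    perfect kernel of iota(A) back to the one of A. As iota is a homeomorphism
    onto a closed set, kernels, scattered parts and their cardinalities
    correspond. The points of the scattered part are pulled back by running the
    inverse of iota on the listed points, but only on those marked 1. *)

(** * Oracle computability *)

Arguments nunpair : simpl never.
Arguments npair : simpl never.

(** Only operators defined on every oracle, so that they compose without conditions on domains. *)
Definition total_computable (F : bseq -> nat -> nat) : Prop :=
  exists c, forall p, computes c p (F p).

Definition code_id : code := Pair Fst Snd.

Lemma eval_id p x : eval p code_id x x.
Proof. by exists (nunpair x).1, (nunpair x).2; rewrite nunpairK. Qed.

Section Closure.
Implicit Types F G H : bseq -> nat -> nat.

Lemma tc_id : total_computable (fun _ n => n).
Proof. by exists code_id => p n; exact: eval_id. Qed.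

Lemma tc_zero : total_computable (fun _ _ => 0).
Proof. by exists Zero. Qed.

Lemma tc_succ F : total_computable F ->
  total_computable (fun p n => (F p n).+1).
Proof.
by move=> [c cF]; exists (Comp Succ c) => p n; exists (F p n); first exact: cF.
Qed.

Lemma tc_const k : total_computable (fun _ _ => k).
Proof. by elim: k => [|k ih]; [exact: tc_zero|exact: tc_succ]. Qed.

Lemma tc_fst F : total_computable F ->
  total_computable (fun p n => (nunpair (F p n)).1).
Proof.
by move=> [c cF]; exists (Comp Fst c) => p n; exists (F p n); first exact: cF.
Qed.

Lemma tc_snd F : total_computable F ->
  total_computable (fun p n => (nunpair (F p n)).2).
Proof.
by move=> [c cF]; exists (Comp Snd c) => p n; exists (F p n); first exact: cF.
Qed.

Lemma tc_oracle F : total_computable F ->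
  total_computable (fun p n => p (F p n)).
Proof.
by move=> [c cF]; exists (Comp Oracle c) => p n; exists (F p n); first exact: cF.
Qed.

Lemma tc_pair F G : total_computable F -> total_computable G ->
  total_computable (fun p n => npair (F p n) (G p n)).
Proof.
by move=> [c cF] [d dG]; exists (Pair c d) => p n; exists (F p n), (G p n); split=> //;
  [exact: cF|exact: dG].
Qed.

Lemma tc_comp F G : total_computable F -> total_computable G ->
  total_computable (fun p n => F p (G p n)).
Proof.
by move=> [c cF] [d dG]; exists (Comp c d) => p n; exists (G p n);
  [exact: dG|exact: cF].
Qed.

(** [Prec] hands its body the packed triple of parameter, index and previous value; the parameter
    here is the input [n] itself. *)
Lemma tc_iteri N F (B : bseq -> nat -> nat -> nat -> nat) :
  total_computable N -> total_computable F ->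
  total_computable (fun p m =>
    B p (nunpair m).1 (nunpair (nunpair m).2).1 (nunpair (nunpair m).2).2) ->
  total_computable (fun p n => iteri (N p n) (B p n) (F p n)).
Proof.
move=> [c cN] [d dF] [e eB]; exists (Comp (Prec d e) (Pair code_id c)) => p n.
exists (npair n (N p n)).
  by exists n, (N p n); split; [exact: eval_id| exact: cN|].
rewrite /= npairK; exists (fun i => iteri i (B p n) (F p n)).
split=> // [|i _]; first exact: dF.
by have := eB p (npair n (npair i (iteri i (B p n) (F p n))));
  rewrite !npairK.
Qed.

End Closure.

Definition decidable_in (B : bseq -> nat -> bool) : Prop :=
  total_computable (fun p n => B p n : nat).

Ltac tc_step :=
  lazymatch goal with
  | |- total_computable (fun p n => n) => exact: tc_id
  | |- total_computable (fun p n => S _) => apply: tc_succ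
  | |- total_computable (fun p n => npair _ _) => apply: tc_pair
  | |- total_computable (fun p n => (nunpair _).1) => apply: tc_fst
  | |- total_computable (fun p n => (nunpair _).2) => apply: tc_snd
  | |- total_computable (fun p n => p _) => apply: tc_oracle
  | |- total_computable (fun p n => iteri _ _ _) =>
      eapply tc_iteri; cbv beta
  | H : total_computable ?F |- total_computable (fun p n => ?F p _) =>
      first [exact: H | apply: (tc_comp H)]
  | |- _ => first [assumption | exact: tc_const]
  end.
Ltac tc := repeat (cbv beta; tc_step).

(** * Arithmetic, decidable predicates and bounded quantifiers *)

Section Arith.
Implicit Types F G H : bseq -> nat -> nat.

Lemma tc_ext F G : (forall p n, F p n = G p n) ->
  total_computable F -> total_computable G.
Proof.
move=> FG; suff -> : F = G by [].
by apply/funext => p; apply/funext => n.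
Qed.

Lemma tc_add F G : total_computable F -> total_computable G ->
  total_computable (fun p n => F p n + G p n).
Proof.
move=> cF cG; apply: (@tc_ext (fun p n => iteri (F p n) (fun _ r => r.+1) (G p n))).
  by move=> p n; elim: (F p n) => //= k ->.
by tc.
Qed.

Lemma tc_mul F G : total_computable F -> total_computable G ->
  total_computable (fun p n => F p n * G p n).
Proof.
move=> cF cG.
apply: (@tc_ext (fun p n => iteri (F p n) (fun _ r => G p n + r) 0)).
  by move=> p n; elim: (F p n) => //= k ->; rewrite mulSn.
by tc; apply: tc_add; tc.
Qed.

Lemma tc_pred F : total_computable F ->
  total_computable (fun p n => (F p n).-1).
Proof.
move=> cF; apply: (@tc_ext (fun p n => iteri (F p n) (fun i _ => i) 0)).
  by move=> p n; case: (F p n).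
by tc.
Qed.

Lemma tc_sub F G : total_computable F -> total_computable G ->
  total_computable (fun p n => F p n - G p n).
Proof.
move=> cF cG.
apply: (@tc_ext (fun p n => iteri (G p n) (fun _ r => r.-1) (F p n))).
  by move=> p n; elim: (G p n) => [|k] /=; rewrite ?subn0// => ->; lia.
by tc; apply: tc_pred; tc.
Qed.

Lemma tc_exp k F : total_computable F ->
  total_computable (fun p n => k ^ F p n).
Proof.
move=> cF; apply: (@tc_ext (fun p n => iteri (F p n) (fun _ r => k * r) 1)).
  by move=> p n; elim: (F p n) => //= m ->; rewrite expnS.
by tc; apply: tc_mul; tc.
Qed.

Lemma tc_if (B : bseq -> nat -> bool) F G :
  decidable_in B -> total_computable F -> total_computable G ->
  total_computable (fun p n => if B p n then F p n else G p n).
Proof.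
move=> cB cF cG.
apply: (@tc_ext (fun p n => iteri (B p n) (fun _ _ => F p n) (G p n))).
  by move=> p n; case: (B p n).
by rewrite /decidable_in in cB; tc.
Qed.

Lemma dec_eq0 F : total_computable F -> decidable_in (fun p n => F p n == 0).
Proof.
move=> cF; apply: (@tc_ext (fun p n => iteri (F p n) (fun _ _ => 0) 1)).
  by move=> p n; case: (F p n).
by tc.
Qed.

Lemma dec_leq F G : total_computable F -> total_computable G ->
  decidable_in (fun p n => F p n <= G p n).
Proof. by move=> cF cG; apply/dec_eq0/tc_sub. Qed.

Lemma dec_and (B C : bseq -> nat -> bool) :
  decidable_in B -> decidable_in C -> decidable_in (fun p n => B p n && C p n).
Proof.
move=> cB cC; apply: tc_ext (tc_mul cB cC) => p n.
by case: (B p n); case: (C p n).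
Qed.

Lemma dec_eq F G : total_computable F -> total_computable G ->
  decidable_in (fun p n => F p n == G p n).
Proof.
move=> cF cG; apply: tc_ext (dec_and (dec_leq cF cG) (dec_leq cG cF)) => p n.
by rewrite eqn_leq.
Qed.

Lemma dec_all (B : bseq -> nat -> nat -> bool) F :
  total_computable F ->
  decidable_in (fun p m => B p (nunpair m).1 (nunpair m).2) ->
  decidable_in (fun p n => all (B p n) (iota 0 (F p n))).
Proof.
move=> cF cB.
apply: (@tc_ext
  (fun p n => iteri (F p n) (fun i r => (B p n i : nat) * r) 1)).
  move=> p n; elim: (F p n) => [//|k ih]; rewrite [LHS]/= ih.
  by rewrite -addn1 iotaD all_cat /= andbT; case: (B p n k); case: (all _ _).
tc; apply: tc_mul; tc.
have := @tc_comp _ (fun _ m => npair (nunpair m).1 (nunpair (nunpair m).2).1) cB.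
by move=> H; apply: tc_ext (H _) => [p n|]; [rewrite npairK|tc].
Qed.

Lemma dec_odd F : total_computable F -> decidable_in (fun p n => odd (F p n)).
Proof.
move=> cF; apply: (@tc_ext (fun p n => iteri (F p n) (fun _ r => 1 - r) 0)).
  by move=> p n; elim: (F p n) => //= k ->; case: (odd k).
by tc; apply: tc_sub; tc.
Qed.

Lemma tc_half F : total_computable F -> total_computable (fun p n => (F p n)./2).
Proof.
move=> cF.
apply: (@tc_ext (fun p n => iteri (F p n) (fun i r => odd i + r) 0)).
  by move=> p n; elim: (F p n) => //= k ->; rewrite uphalf_half.
by tc; apply: tc_add; tc; apply: dec_odd; tc.
Qed.

Lemma tc_double F : total_computable F -> total_computable (fun p n => (F p n).*2).
Proof. by move=> cF; apply: tc_ext (tc_add cF cF) => p n; rewrite addnn. Qed.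

(** Dropping the head becomes an iteration, a form that [tc_iteri] accepts; the code 0 is a fixed
    point because [nunpair 0] is [(0, 0)]. *)
Lemma finseqE n k :
  finseq n k =
  (nunpair (iteri k (fun _ r => (nunpair r.-1).2) n).-1).1.
Proof.
have nunpair0 : nunpair 0 = (0, 0) by [].
suff H m : finseq (iteri m (fun _ r => (nunpair r.-1).2) n) k =
    (nunpair (iteri (m + k) (fun _ r => (nunpair r.-1).2) n).-1).1.
  by have := H 0.
elim: k m => [|k ih] m; first by rewrite addn0; case: (iteri _ _ _).
rewrite addnS -addSn -ih [in RHS]/=.
by case: (iteri _ _ _) => [|//]; rewrite nunpair0; case: k {ih}.
Qed.

Lemma tc_finseq F G : total_computable F -> total_computable G ->
  total_computable (fun p n => finseq (F p n) (G p n)).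
Proof.
move=> cF cG; apply: tc_ext (fun p n => esym (finseqE _ _)) _.
by tc; apply: tc_pred; tc; apply: tc_pred; tc.
Qed.

End Arith.

Ltac tc_head :=
  lazymatch goal with
  | |- total_computable (fun p n => _ + _) => apply: tc_add
  | |- total_computable (fun p n => _ - _) => apply: tc_sub
  | |- total_computable (fun p n => _ * _) => apply: tc_mul
  | |- total_computable (fun p n => _ ^ _) => apply: tc_exp
  | |- total_computable (fun p n => _.-1) => apply: tc_pred
  | |- total_computable (fun p n => _./2) => apply: tc_half
  | |- total_computable (fun p n => _.*2) => apply: tc_double
  | |- total_computable (fun p n => finseq _ _) => apply: tc_finseq
  | |- total_computable (fun p n => if _ then _ else _) => apply: tc_if
  | |- total_computable (fun p n => nat_of_bool (@?B p n)) =>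
      change (decidable_in B)
  | |- decidable_in (fun p n => _ == 0) => apply: dec_eq0
  | |- decidable_in (fun p n => _ == _) => apply: dec_eq
  | |- decidable_in (fun p n => _ <= _) => apply: dec_leq
  | |- decidable_in (fun p n => _ && _) => apply: dec_and
  | |- decidable_in (fun p n => odd _) => apply: dec_odd
  | |- decidable_in (fun p n => all _ _) => apply: dec_all
  | |- _ => fail
  end.
Ltac tcomp := repeat (cbv beta; first [tc_step | tc_head]).

(** * Finite approximations of computations *)

(* The oracle is known only below [s], where it agrees with [finseq e], and [Mu]
   searches below [s]. The result [0] means that no value was found, and [y.+1]
   stands for the value [y]. *)
Fixpoint run (c : code) (e s x : nat) : nat :=
  match c with
  | Zero => 1
  | Succ => x.+2
  | Fst => (nunpair x).1.+1
  | Snd => (nunpair x).2.+1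
  | Oracle => if x < s then (finseq e x).+1 else 0
  | Pair a b =>
      if run a e s x == 0 then 0 else
      if run b e s x == 0 then 0 else
      (npair (run a e s x).-1 (run b e s x).-1).+1
  | Comp a b => if run b e s x == 0 then 0 else run a e s (run b e s x).-1
  | Prec a b =>
      iteri (nunpair x).2 (fun i r => if r == 0 then 0 else
          run b e s (npair (nunpair x).1 (npair i r.-1)))
        (run a e s (nunpair x).1)
  | Mu a =>
      (* state [0]: searching, [1]: a value is undefined, [y.+2]: [y] found *)
      (iteri s (fun i r => if r == 0 then
          (if run a e s (npair x i) == 0 then 1 else
           if run a e s (npair x i) == 1 then i.+2 else 0) else r) 0).-1
  end.

(** Since [c] is fixed, the recursion on codes takes place outside the programs, and no universal
    program is built. *)
Lemma tc_run c F G H :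
  total_computable F -> total_computable G -> total_computable H ->
  total_computable (fun p n => run c (F p n) (G p n) (H p n)).
Proof.
elim: c F G H => [|||||a iha b ihb|a iha b ihb|a iha b ihb|a iha] F G H cF cG cH /=;
  by repeat (cbv beta; first [tc_step | tc_head | apply: iha | apply: ihb ]).
Qed.

(** Only the prefix coded by [e] is read, so a value found is valid for every oracle extending that
    prefix. *)
Lemma run_sound c p e s : (forall k, k < s -> p k = finseq e k) ->
  forall x y, run c e s x = y.+1 -> eval p c x y.
Proof.
move=> pe.
elim: c => [|||||a iha b ihb|a iha b ihb|a iha b ihb|a iha] x y /=;
  do ?by case.
- by case: ifP => // xs [<-]; rewrite pe.
- case Ea: (run a e s x) => [|u] //=; case Eb: (run b e s x) => [|v] //= [<-].
  by exists u, v; split=> //; [exact: iha|exact: ihb].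
- case Eb: (run b e s x) => [|v] //= Ea.
  by exists v; [exact: ihb|exact: iha].
- case: (nunpair x) => u n /=.
  set g := fun i r => _ => E.
  exists (fun i => (iteri i g (run a e s u)).-1).
  (* Zero is absorbing for [g], so a nonzero final value makes all the earlier ones nonzero. *)
  have pos i : i <= n -> iteri i g (run a e s u) != 0.
    apply: contraPneq => i0 le_in; move: E; rewrite -(subnKC le_in).
    suff -> : iteri (i + (n - i)) g (run a e s u) = 0 by [].
    by elim: (n - i) => [|k ih]; rewrite ?addn0// addnS /= ih.
  have predK i : i <= n -> iteri i g (run a e s u) =
      (iteri i g (run a e s u)).-1.+1.
    by move=> /pos; case: (iteri _ _ _).
  split=> [|i lt_in|]; last by rewrite E.
    by apply: iha; exact: predK 0 (leq0n n).
  apply: ihb; rewrite -(predK i.+1 lt_in) /= {2}/g.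
  by rewrite (negPf (pos i (ltnW lt_in))).
- set g := fun i r => _ => E.
  (* The invariant of the search: what each state guarantees after [m] rounds. *)
  suff H m : match iteri m g 0 with
      | 0 => forall z, z < m -> exists v, eval p a (npair x z) v.+1
      | 1 => True
      | y.+2 => eval p a (npair x y) 0 /\
          forall z, z < y -> exists v, eval p a (npair x z) v.+1
      end.
    by have := H s; case: (iteri s g 0) E => [|[|w]] //= [->].
  elim: m => [|m] //=; rewrite {2}/g.
  case: (iteri m g 0) => [|[|w]] //= ih.
  case Em: (run a e s (npair x m)) => [|[|v]] //=.
    by split=> //; exact: iha.
  move=> z; rewrite ltnS leq_eqVlt => /predU1P[->|/ih //].
  by exists v; exact: iha.
Qed.

(** The use principle: a halting computation reads finitely many oracle values. The bound serves all
    larger [s], so the bounds of subcomputations combine by [maxn]. *)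
Lemma run_complete c p x y : eval p c x y -> exists s0, forall s e, s0 <= s ->
  (forall k, k < s -> p k = finseq e k) -> run c e s x = y.+1.
Proof.
elim: c x y => [|||||a iha b ihb|a iha b ihb|a iha b ihb|a iha] x y /=.
1-4: by move=> ->; exists 0.
- by move=> ->; exists x.+1 => s e xs pe; rewrite xs pe.
- move=> [u [v [/iha[s1 H1] /ihb[s2 H2] ->]]]; exists (maxn s1 s2) => s e.
  by rewrite geq_max => /andP[l1 l2] pe; rewrite (H1 s e)// (H2 s e).
- move=> [u /ihb[s1 H1] /iha[s2 H2]]; exists (maxn s1 s2) => s e.
  by rewrite geq_max => /andP[l1 l2] pe; rewrite (H1 s e)//= (H2 s e).
- case: (nunpair x) => u n [w [/iha[s1 H1] wS ->]] /=.
  elim: n wS => [|n ih] wS; first by exists s1 => s e ls pe /=; rewrite (H1 s e).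
  have [i lt_in|s2 H2] := ih; first by apply: wS; exact: ltnW.
  have [s3 H3] := ihb _ _ (wS n (ltnSn n)).
  exists (maxn s2 s3) => s e; rewrite geq_max => /andP[l2 l3] pe /=.
  by rewrite (H2 s e)//= (H3 s e).
- move=> [/iha[s1 H1] lt_y].
  have [s2 H2] : exists s2, forall s e, s2 <= s ->
      (forall k, k < s -> p k = finseq e k) ->
      forall z, z < y -> exists v, run a e s (npair x z) = v.+2.
    elim: y lt_y {H1} => [|y ih] lt_y; first by exists 0.
    have [z zy|s2 H2] := ih; first by apply: lt_y; exact: ltnW.
    have [v /iha[s3 H3]] := lt_y y (ltnSn y).
    exists (maxn s2 s3) => s e; rewrite geq_max => /andP[l2 l3] pe z.
    rewrite ltnS leq_eqVlt => /predU1P[->|]; first by exists v; exact: H3.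
    exact: H2.
  (* The search tests [y] itself only in round [y.+1]. *)
  exists (maxn y.+1 (maxn s1 s2)) => s e.
  rewrite !geq_max => /and3P[ys l1 l2] pe.
  set g := fun i r => _.
  suff H m : iteri m g 0 = if m <= y then 0 else y.+2 by rewrite H leqNgt ys.
  elim: m => //= m ->; rewrite {1}/g; case: (ltngtP m y) => //= [my|->].
    by have [v ->] := H2 s e l2 pe m my.
  by rewrite (H1 s e).
Qed.

(** * Substitution of computable oracles *)

Definition code_assocr : code :=
  Pair (Comp Fst Fst) (Pair (Comp Snd Fst) Snd).

(** [Prec] and [Mu] append their own arguments outside the pair that holds the parameter;
    reassociating brings the parameter back to the front. *)
Lemma eval_assocr p x y z :
  eval p code_assocr (npair (npair x y) z) (npair x (npair y z)).
Proof.
exists x, (npair y z); split=> //=.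
  by exists (npair x y); rewrite npairK.
exists y, z; split=> //; last by rewrite npairK.
by exists (npair x y); rewrite npairK.
Qed.

(* [subst o c] runs [c] on the second component of its input, its oracle being
   computed by [o] with the first component as a parameter. *)
Fixpoint subst (o c : code) : code :=
  match c with
  | Zero => Zero
  | Succ => Comp Succ Snd
  | Fst => Comp Fst Snd
  | Snd => Comp Snd Snd
  | Oracle => o
  | Pair a b => Pair (subst o a) (subst o b)
  | Comp a b => Comp (subst o a) (Pair Fst (subst o b))
  | Prec a b =>
      Comp (Prec (subst o a) (Comp (subst o b) code_assocr))
           (Pair (Pair Fst (Comp Fst Snd)) (Comp Snd Snd))
  | Mu a => Mu (Comp (subst o a) code_assocr)
  end.

(** The parameter [i] is carried through every input, so one program serves a whole sequence of
    oracles. *)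
Lemma eval_subst o c p r i : (forall k, eval p o (npair i k) (r k)) ->
  forall x y, eval r c x y -> eval p (subst o c) (npair i x) y.
Proof.
move=> or.
elim: c => [|||||a iha b ihb|a iha b ihb|a iha b ihb|a iha] x y /=.
- by [].
1-3: by move=> ->; exists x => //; rewrite npairK.
- by move=> ->; exact: or.
- by move=> [u [v [/iha au /ihb bv ->]]]; exists u, v.
- move=> [u /ihb bu /iha au]; exists (npair i u) => //.
  by exists i, u; split=> //; rewrite npairK.
- case Ex: (nunpair x) => [u n] [w [/iha w0 wS ->]].
  exists (npair (npair i u) n).
    exists (npair i u), n; split=> //; last by exists x; rewrite ?npairK ?Ex.
    exists i, u; split=> //; rewrite ?npairK//.
    by exists x; rewrite ?npairK ?Ex.
  rewrite npairK; exists w; split=> // j /wS /ihb wj.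
  by exists (npair i (npair u (npair j (w j)))) => //; exact: eval_assocr.
- move=> [/iha a0 lt_y]; split.
    by exists (npair i (npair x y)) => //; exact: eval_assocr.
  move=> z /lt_y[v /iha av]; exists v.
  by exists (npair i (npair x z)) => //; exact: eval_assocr.
Qed.

Lemma tc_subst F (G : bseq -> bseq) :
  total_computable F -> total_computable G ->
  total_computable (fun p => F (G p)).
Proof.
move=> [c cF] [d dG]; exists (Comp (subst (Comp d Snd) c) (Pair Zero code_id)).
move=> p n; exists (npair 0 n).
  by exists 0, n; split=> //; exact: eval_id.
apply: eval_subst (cF _ _) => k; exists k; first by rewrite /= npairK.
exact: dG.
Qed.

(** A program for [f] expects the zero oracle, which [Zero] supplies whatever the actual oracle
    is. *)
Lemma tc_seq (f : bseq) F : computable_seq f -> total_computable F ->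
  total_computable (fun p n => f (F p n)).
Proof.
move=> [c cf]; apply: (@tc_comp (fun _ => f)).
exists (Comp (subst Zero c) (Pair Zero code_id)) => p n; exists (npair 0 n).
  by exists 0, n; split=> //; exact: eval_id.
by apply: eval_subst (cf n) => k.
Qed.

(* [guard t d c] runs [c] only where [t] yields [1], and [d] everywhere. *)
Definition guard (t d c : code) : code :=
  Comp (Prec d (Comp c Fst)) (Pair code_id t).

(** This is a primitive recursion of length [b]: if [b] is false, [c] is never run and may diverge;
    if [b] is true, the single step discards the value of [d]. *)
Lemma eval_guard t d c p n (b : bool) y z :
  eval p t n b -> eval p d n y -> (b -> eval p c n z) ->
  eval p (guard t d c) n (if b then z else y).
Proof.
move=> tn dn cn; exists (npair n b).
  by exists n, b; split=> //; exact: eval_id.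
rewrite /= npairK; case: b cn {tn} => [/(_ isT) cn|_].
  exists (fun i => if i is 0 then y else z); split=> // -[|//] _.
  by exists n => //=; rewrite npairK.
by exists (fun=> y).
Qed.

(** * Metric names *)

Definition qpos (m : nat) : nat := (nunpair (nunpair m).1).1.
Definition qneg (m : nat) : nat := (nunpair (nunpair m).1).2.
Definition qden (m : nat) : nat := (nunpair m).2.+1.

(* [q_e + 2 * 2^-k < q_m], after clearing denominators. *)
Definition qgap (k e m : nat) : bool :=
  2 ^ k * qden m * qpos e + 2 * qden e * qden m + 2 ^ k * qden e * qneg m
  < 2 ^ k * qden e * qpos m + 2 ^ k * qden m * qneg e.

(** The index of 2^-l: numerator 1 - 0, and 2^l - 1 because denominators are stored minus one. *)
Definition qpow (l : nat) : nat := npair (npair 1 0) (2 ^ l).-1.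

Lemma dec_qgap F G H :
  total_computable F -> total_computable G -> total_computable H ->
  decidable_in (fun p n => qgap (F p n) (G p n) (H p n)).
Proof. by move=> cF cG cH; rewrite /qgap /qpos /qneg /qden; tcomp. Qed.

Lemma tc_qpow F : total_computable F -> total_computable (fun p n => qpow (F p n)).
Proof. by move=> cF; rewrite /qpow; tcomp. Qed.

Local Open Scope classical_set_scope.
Local Open Scope ring_scope.

(** * Dyadic precisions and comparison of rationals *)

Section Rational.
Variable R : realType.

Lemma half_pow_gt0 k : 0 < (2^-1 ^+ k : R).
Proof. by rewrite exprn_gt0// invr_gt0. Qed.

Lemma half_powE k : (2^-1 ^+ k : R) = (2 ^ k)%:R^-1.
Proof. by rewrite natrX exprVn. Qed.

Lemma half_pow_le k l : (k <= l)%N -> (2^-1 ^+ l : R) <= 2^-1 ^+ k.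
Proof.
by move=> kl; rewrite ler_wiXn2l ?invr_ge0// ?invf_le1 ?ler1n.
Qed.

Lemma half_pow_small (e : R) : 0 < e -> exists k, 2^-1 ^+ k < e.
Proof.
move=> e0; have : (2^-1 ^+ n : R) @[n --> \oo] --> 0.
  by apply: cvg_expr; rewrite ger0_norm ?invr_ge0// invf_lt1 ?ltr1n.
by move=> /cvgr_lt /(_ e e0)[n _ /(_ n (leqnn n))]; exists n.
Qed.

Lemma ratr_qenum m :
  ratr (qenum m) = ((qpos m)%:R - (qneg m)%:R) / (qden m)%:R :> R.
Proof.
rewrite /qenum /qpos /qneg /qden; case: (nunpair m) => a b /=.
by case: (nunpair a) => s t /=; rewrite fmorph_div rmorphB /= !ratr_nat.
Qed.

Lemma ratr_qpow l : ratr (qenum (qpow l)) = 2^-1 ^+ l :> R.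
Proof.
rewrite ratr_qenum /qpos /qneg /qden /qpow !npairK /= subr0 div1r half_powE.
by rewrite prednK ?expn_gt0.
Qed.

Lemma qgapP k e m :
  qgap k e m = (ratr (qenum e) + 2 * 2^-1 ^+ k < ratr (qenum m) :> R).
Proof.
rewrite !ratr_qenum half_powE /qgap -(ltr_nat R) !natrD !natrM.
have : (0 : R) < (qden e)%:R by rewrite ltr0n.
have : (0 : R) < (qden m)%:R by rewrite ltr0n.
have : (0 : R) < (2 ^ k)%:R by rewrite ltr0n expn_gt0.
move: (qden e)%:R (qden m)%:R (2 ^ k)%:R (qpos e)%:R (qneg e)%:R
  (qpos m)%:R (qneg m)%:R => a b c s t u v c0 b0 a0.
have abc : 0 < a * b * c by rewrite !mulr_gt0.
rewrite -[RHS](ltr_pM2r abc).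
have -> : ((s - t) / a + 2 * c^-1) * (a * b * c) =
    (s - t) * (a / a) * b * c + 2 * a * b * (c / c) by lra.
have -> : (u - v) / b * (a * b * c) = (u - v) * (b / b) * a * c by lra.
rewrite !divff ?gt_eqF//.
apply/idP/idP; lra.
Qed.

End Rational.

Section Names.
Context {R : realType}.
Implicit Types X : sepMetric R.

Lemma cauchy_name_dist X p (x : X) j : cauchy_name p x ->
  mdist x (spt X (p j)) <= 2^-1 ^+ j.
Proof.
move=> [pc px]; apply/ler_addgt0Pl => e e0.
move/metricType_numDomainType.cvgrPdist_lt : px => /(_ e e0)[N _ HN].
(* This index is late enough to be close to the limit and also exceeds [j]. *)
have := HN (maxn N j.+1) (leq_maxl _ _).
have /= := pc (maxn N j.+1) j (leq_maxr _ _).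
have := metric_triangle x (spt X (p (maxn N j.+1))) (spt X (p j)).
by set d := mdist _ _; set d1 := mdist _ _; set d2 := mdist _ _; lra.
Qed.

(** Each value is constrained separately, by its distance to the limit, so names can be spliced from
    prefixes and tails. *)
Lemma fast_cauchy_name X p (x : X) :
  (forall j, mdist x (spt X (p j)) < 2^-1 ^+ j.+1) -> cauchy_name p x.
Proof.
move=> px; split=> [i j ji|].
  apply: le_lt_trans (metric_triangle _ x _) _; rewrite metric_sym.
  have := @half_pow_le R j.+1 i.+1 (ltnW ji).
  by have := px i; have := px j; rewrite !exprS; lra.
apply/metricType_numDomainType.cvgrPdist_lt => e e0.
have [k ke] := half_pow_small e0.
exists k => // n /= kn; apply: lt_trans (px n) _; apply: le_lt_trans ke.
by apply: half_pow_le; exact: leqW.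
Qed.

Lemma rballE X i (x : X) : rball i x =
  (mdist x (spt X (nunpair i).1) < ratr (qenum (nunpair i).2)) :> Prop.
Proof. by rewrite /rball; case: (nunpair i). Qed.

Lemma rball_open X i : open (@rball R X i).
Proof.
rewrite openE => x; rewrite rballE => xi; apply/nbhs_ballP.
exists (ratr (qenum (nunpair i).2) - mdist x (spt X (nunpair i).1)) => /=.
  by rewrite subr_gt0.
move=> y; rewrite ballEmdist /= rballE => xy.
apply: le_lt_trans (metric_triangle _ x _) _.
by rewrite (metric_sym y); lra.
Qed.

Lemma neg_name_closed X p (A : set X) : neg_name p A -> closed A.
Proof.
by move=> ->; apply: open_closedC; apply: bigcup_open => i _; exact: rball_open.
Qed.

End Names.

(** * Effective continuity *)

(** A decidable substitute for the merely semidecidable strict inequality between a distance and a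
    rational: at precision [k] it is sound with margin 2^-k to spare, and succeeds once the margin
    is 3 * 2^-k. *)
Definition dist_lt (f : bseq) (a b k m : nat) : bool :=
  qgap k (f (npair a (npair b k))) m.

Lemma dec_dist_lt f A B K M : computable_seq f ->
  total_computable A -> total_computable B ->
  total_computable K -> total_computable M ->
  decidable_in (fun p n => dist_lt f (A p n) (B p n) (K p n) (M p n)).
Proof.
by move=> cf cA cB cK cM; apply: dec_qgap => //; apply: tc_seq => //; tcomp.
Qed.

Section Preimage.
Context {R : realType}.

Definition dist_approx (X : sepMetric R) (f : bseq) : Prop := forall i j k,
  `|mdist (spt X i) (spt X j) - ratr (qenum (f (npair i (npair j k))))|
    < 2^-1 ^+ k.

Lemma dist_lt_sound X f a b k m : dist_approx X f -> dist_lt f a b k m ->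
  mdist (spt X a) (spt X b) + 2^-1 ^+ k < ratr (qenum m).
Proof.
move=> fX; rewrite /dist_lt (qgapP R) => gap.
by have := fX a b k; rewrite ltr_norml => /andP[_]; lra.
Qed.

Lemma dist_lt_complete X f a b k m : dist_approx X f ->
  mdist (spt X a) (spt X b) + 3 * 2^-1 ^+ k <= ratr (qenum m) ->
  dist_lt f a b k m.
Proof.
move=> fX dm; rewrite /dist_lt (qgapP R).
by have := fX a b k; rewrite ltr_norml => /andP[+ _]; lra.
Qed.

(** A ball of radius 0: the output where a test fails, as a negative name lists a ball at every
    position. *)
Definition empty_ball : nat := npair 0 (npair (npair 0 0) 0).

Lemma rball_empty (X : sepMetric R) (x : X) : ~ rball empty_ball x.
Proof.
rewrite rballE /empty_ball npairK /= ratr_qenum /qpos /qneg !npairK /=.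
by rewrite subrr mul0r ltNge mdist_ge0.
Qed.

(* [t] codes [<e,s,n,i,j>]. The ball around the [n]-th point is enumerated when
   all of its points have a name starting with the first [s] values of
   [finseq e], and [c] maps all such names to names whose [j]-th value already
   places the image in the ball [p i]. *)
Definition preimage_ball (fY fZ : bseq) (c : code) (p : bseq) (t : nat) : nat :=
  let e := (nunpair t).1 in
  let s := (nunpair (nunpair t).2).1 in
  let n := (nunpair (nunpair (nunpair t).2).2).1 in
  let i := (nunpair (nunpair (nunpair (nunpair t).2).2).2).1 in
  let j := (nunpair (nunpair (nunpair (nunpair t).2).2).2).2 in
  if all (fun k => dist_lt fY n (finseq e k) (s + 4) (qpow k.+1)) (iota 0 s)
    && (0 < run c e s j)%N
    && dist_lt fZ (run c e s j).-1 (nunpair (p i)).1 j (nunpair (p i)).2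
  then npair n (qpow (s + 4)) else empty_ball.

Lemma tc_preimage_ball fY fZ c : computable_seq fY -> computable_seq fZ ->
  total_computable (preimage_ball fY fZ c).
Proof.
move=> cY cZ; rewrite /preimage_ball; cbv zeta.
repeat (cbv beta; first
  [ apply: dec_dist_lt => // | apply: tc_qpow | apply: tc_run
  | tc_step | tc_head ]).
Qed.

(** A point of the ball gets a name by splicing the prefix coded by [e] with a fast tail; the run
    then fixes the [j]-th value of every output on that name. *)
Lemma preimage_ball_sound (Y Z : sepMetric R) fY fZ c p t (y : Y) :
  dist_approx Y fY -> dist_approx Z fZ ->
  rball (preimage_ball fY fZ c p t) y ->
  exists2 p', cauchy_name p' y &
    forall (q : bseq) (z : Z), computes c p' q -> cauchy_name q z ->
      exists i, rball (p i) z.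
Proof.
move=> hY hZ; rewrite /preimage_ball.
move: (nunpair t).1 (nunpair t).2 => e t1.
move: (nunpair t1).1 (nunpair t1).2 => s t2.
move: (nunpair t2).1 (nunpair t2).2 => n t3.
move: (nunpair t3).1 (nunpair t3).2 => i j {t t1 t2 t3}.
case: ifP => [/andP[/andP[/allP near run0] close] yn|_ /rball_empty //].
have {}yn : mdist y (spt Y n) < 2^-1 ^+ (s + 4)%N.
  by move: yn; rewrite rballE npairK /= ratr_qpow.
have /choice[g yg] := fun k => spt_near y (half_pow_gt0 R k.+1).
pose p' k := if (k < s)%N then finseq e k else g k.
exists p'.
  apply: fast_cauchy_name => k; rewrite /p'; case: ifP => ks; last exact: yg.
  (* The margin 2^-(s+4) of the test equals the radius of the ball around point [n]. *)
  have /(dist_lt_sound hY) : dist_lt fY n (finseq e k) (s + 4) (qpow k.+1).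
    by apply: near; rewrite mem_iota.
  rewrite ratr_qpow.
  by have := metric_triangle y (spt Y n) (spt Y (finseq e k)); lra.
move=> q z cq qz; exists i; rewrite rballE.
have Er : run c e s j = (run c e s j).-1.+1 by rewrite prednK.
have qj : q j = (run c e s j).-1.
  apply: eval_fun (cq j) _; apply: run_sound Er => k ks.
  by rewrite /p' ks.
(* Here the margin 2^-j absorbs the error of the [j]-th approximation to [z]. *)
have := dist_lt_sound hZ close; rewrite -qj.
have := cauchy_name_dist j qz.
by have := metric_triangle z (spt Z (q j)) (spt Z (nunpair (p i)).1); lra.
Qed.

Lemma preimage_ball_complete (Y Z : sepMetric R) fY fZ c p i (y : Y) (z : Z) :
  dist_approx Y fY -> dist_approx Z fZ ->
  (forall p' : bseq, cauchy_name p' y ->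
    exists q : bseq, computes c p' q /\ cauchy_name q z) ->
  @rball R Z (p i) z -> exists t, @rball R Y (preimage_ball fY fZ c p t) y.
Proof.
move=> hY hZ cyz; rewrite rballE; set n' := (nunpair _).1; set m' := _.2 => zn'.
(* Twice as tight as a fast name has to be, which leaves room for all points near [y] to share the
   prefix. *)
have /choice[p' yp'] := fun k => spt_near y (half_pow_gt0 R k.+2).
have [|q [cq qz]] := cyz p'.
  by apply: fast_cauchy_name => k; apply: lt_le_trans (yp' k) (half_pow_le _ _).
(* A quarter, because the test needs three times 2^-j and the approximation [q j] costs one more. *)
have [j zj] : exists j, 2^-1 ^+ j < (ratr (qenum m') - mdist z (spt Z n')) / 4.
  by apply: half_pow_small; lra.
have [s Hs] := run_complete (cq j).
have [e Ee] := finseq_dense p' s.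
have run_j : run c e s j = (q j).+1 by apply: Hs => // k ks; rewrite Ee.
have [n yn] := spt_near y (half_pow_gt0 R (s + 4)).
exists (npair e (npair s (npair n (npair i j)))).
rewrite /preimage_ball !npairK /= run_j /= -/n' -/m' andbT.
have -> : dist_lt fZ (q j) n' j m'.
  apply: (dist_lt_complete hZ); have := cauchy_name_dist j qz.
  have := metric_triangle (spt Z (q j)) z (spt Z n').
  by rewrite (metric_sym (spt Z (q j)) z); lra.
have -> : all (fun k => dist_lt fY n (finseq e k) (s + 4) (qpow k.+1)) (iota 0 s).
  apply/allP => k; rewrite mem_iota /= add0n => ks; rewrite Ee//.
  (* Three errors 2^-(s+4) from the test and one from [y] make 2^-(s+2), at most 2^-(k+2); with the
     bound on [p' k] this gives 2^-(k+1). *)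
  apply: (dist_lt_complete hY); rewrite ratr_qpow.
  have := metric_triangle (spt Y n) y (spt Y (p' k)).
  rewrite (metric_sym (spt Y n) y); have := yp' k.
  have := @half_pow_le R k.+2 s.+2 ltac:(lia).
  by move: yn; rewrite addnC /= !exprS; lra.
by rewrite /= rballE npairK /= ratr_qpow.
Qed.

Definition functional (Y Z : repSpace) (h : problem Y Z) : Prop :=
  forall y z z', h y z -> h y z' -> z = z'.

(** The set named by [F p] is controlled only on the domain of [h]; this form covers the partial
    inverse of an embedding. *)
Lemma computable_preimage (Y Z : sepMetric R)
    (h : problem (cauchy_rep Y) (cauchy_rep Z)) :
  computable_metric Y -> computable_metric Z -> functional h ->
  computable_problem h ->
  exists2 F, total_computable F & forall p (B : set Z), neg_name p B ->
    forall y z, h y z -> (~` \bigcup_i @rball R Y (F p i)) y <-> B z.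
Proof.
move=> [fY [cY hY]] [fZ [cZ hZ]] fun_h [c ch].
exists (preimage_ball fY fZ c); first exact: tc_preimage_ball.
move=> p B -> y z hyz.
have name_z (p' : bseq) : cauchy_name p' y ->
    exists q : bseq, computes c p' q /\ cauchy_name q z.
  move=> p'y; have [|q [z' [cq qz' hyz']]] := ch p' y p'y; first by exists z.
  by rewrite (fun_h _ _ _ hyz hyz'); exists q.
split; apply: contra_not => -[].
  by move=> i _ /(preimage_ball_complete hY hZ name_z)[t yt]; exists t.
move=> t _ /(preimage_ball_sound hY hZ)[p' /name_z[q [cq qz]] /(_ q z cq qz)].
by move=> [i zi]; exists i.
Qed.

End Preimage.

(** * Closed embeddings *)

(** The length of the longest common prefix, capped at [k]: the test [r == m] freezes the counter at
    the first disagreement. *)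
Definition agree (i j k : nat) : nat :=
  iteri k (fun m r => if (r == m) && (finseq i m == finseq j m) then m.+1 else r) 0.

Arguments agree : simpl never.

Lemma agreeP i j k : [/\ (agree i j k <= k)%N,
  forall m, (m < agree i j k)%N -> finseq i m = finseq j m &
  (agree i j k < k)%N -> finseq i (agree i j k) != finseq j (agree i j k)].
Proof.
elim: k => [//|k [le_k eq_lt ne]]; rewrite /agree /= -/(agree i j k).
have [ak|ak] := eqVneq (agree i j k) k; last first.
  by split=> //= [|_]; [exact: leqW|apply: ne; rewrite ltn_neqAle ak].
have [ek|ek] := eqVneq (finseq i k) (finseq j k) => /=; last first.
  by rewrite ak; split=> // m mk; apply: eq_lt; rewrite ak.
split=> [//|m|]; last by rewrite ltnn.
by rewrite ltnS leq_eqVlt => /predU1P[->//|mk]; apply: eq_lt; rewrite ak.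
Qed.

(** Inspecting [k.+1] entries either finds the first disagreement, hence the exact distance, or
    bounds the distance by 2^-(k+1). *)
Lemma computable_baire (R : realType) : computable_metric (baire R).
Proof.
pose F (_ : bseq) n := qpow (agree (nunpair n).1 (nunpair (nunpair n).2).1
  (nunpair (nunpair n).2).2.+1).
have [c cF] : total_computable F by apply: tc_qpow; rewrite /agree; tcomp.
exists (F (fun=> 0%N)); split=> [|i j k]; first by exists c.
rewrite /F !npairK /= ratr_qpow; set a := agree _ _ _.
have [le_a eq_lt ne] := agreeP i j k.+1; rewrite -/a in le_a eq_lt ne.
set d := mdist _ _.
have d0 : 0 <= d by exact: mdist_ge0.
have da : d <= 2^-1 ^+ a by apply/seqdist_le => m ma; exact: eq_lt.
have [ak|ak] := eqVneq a k.+1.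
  rewrite ltr_norml; move: da; rewrite ak exprS.
  by have := half_pow_gt0 R k => k0 da; apply/andP; split; lra.
suff ad : 2^-1 ^+ a <= d.
  have -> : d = 2^-1 ^+ a by apply/eqP; rewrite eq_le da ad.
  by rewrite subrr normr0 half_pow_gt0.
(* Distances are 0 or powers of 1/2, so it suffices to exclude those below 2^-a. *)
have far n : (a < n)%N -> ~ d <= 2^-1 ^+ n.
  move=> an /seqdist_le /(_ a an) /eqP; apply/negP/ne.
  by rewrite ltn_neqAle ak.
have [dE|[n dE]] := seqdist_dyadic (seqpt R id i) (seqpt R id j).
  by case: (far a.+1) => //; rewrite /d /= [X in X <= _]dE ltW// half_pow_gt0.
rewrite /d /= [X in _ <= X]dE; apply: half_pow_le; rewrite leqNgt; apply/negP => an.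
by apply: (far n an); rewrite /d /= [X in X <= _]dE.
Qed.

Lemma perfect_setP (T : topologicalType) (A : set T) :
  perfect_set A <-> closed A /\ A `<=` limit_point A.
Proof.
split=> [[cA lA]|[cA lA]]; first by split=> //; rewrite lA.
split=> //; apply/seteqP; split=> // x xA; apply: cA => U /xA[y [_ Ay Uy]].
by exists y.
Qed.

Lemma functional_fun (Y Z : repSpace) (f : Y -> Z) :
  functional (fun y => [set f y]).
Proof. by move=> y z z' -> ->. Qed.

Lemma functional_inverse (Y Z : repSpace) (f : Y -> Z) :
  injective f -> functional (fun z => [set y | f y = z]).
Proof. by move=> inj z y y' <- /inj. Qed.

Section Embedding.
Context {R : realType}.

(** Plain continuity of [h] on its domain, obtained by forgetting that [F] is computable. *)
Lemma computable_closed_preimage (Y Z : sepMetric R)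
    (h : problem (cauchy_rep Y) (cauchy_rep Z)) (B : set Z) :
  computable_metric Y -> computable_metric Z -> functional h ->
  computable_problem h -> closed B ->
  exists2 C : set Y, closed C & forall y z, h y z -> C y <-> B z.
Proof.
move=> cY cZ fun_h ch /neg_name_surj[p pB].
have [F _ HF] := computable_preimage cY cZ fun_h ch.
exists (~` \bigcup_i @rball R Y (F p i)); last exact: HF.
exact: (@neg_name_closed R Y (F p)).
Qed.

(** Continuity brings nearby points of [S] into the given neighbourhood, and injectivity keeps their
    images distinct from [z]. *)
Lemma limit_point_image (Y Z : sepMetric R)
    (h : problem (cauchy_rep Y) (cauchy_rep Z)) (S : set Y) (T : set Z) y z :
  computable_metric Y -> computable_metric Z -> functional h ->
  computable_problem h -> (forall y y' z, h y z -> h y' z -> y = y') ->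
  (forall y, S y -> exists2 z, h y z & T z) ->
  limit_point S y -> h y z -> limit_point T z.
Proof.
move=> cY cZ fun_h ch inj_h ST Sy hyz U; rewrite nbhsE => -[V [oV Vz] VU].
have [C cC HC] := computable_closed_preimage cY cZ fun_h ch (open_closedC oV).
have [|y' [y'y Sy' Cy']] := Sy (~` C).
  apply: open_nbhs_nbhs; split; first exact: closed_openC.
  by move=> /(HC _ _ hyz); apply.
have [z' hyz' Tz'] := ST y' Sy'; exists z'; split=> //.
  by apply: contra_neq y'y => zz; apply: (inj_h _ _ z) => //; rewrite -zz.
apply: VU; apply: contrapT => nVz'; apply: Cy'; exact/(HC _ _ hyz').
Qed.

Variables (Y X : sepMetric R) (iota : cauchy_rep Y -> cauchy_rep X).
Hypotheses (cY : computable_metric Y) (cX : computable_metric X).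
Hypotheses (emb : computable_embedding iota) (cl : closed (range iota : set X)).

Let fun_iota := functional_fun (f := iota).

Let fun_inv : functional (fun x => [set y | iota y = x]).
Proof. by case: emb => inj _ _; exact: functional_inverse. Qed.

Lemma closed_embedding (A : set Y) : closed A <-> closed (iota @` A : set X).
Proof.
have [inj ci cv] := emb; split=> cA.
  have [C cC HC] := computable_closed_preimage cX cY fun_inv cv cA.
  (* [C] is determined only on the range, so closedness of the range is what makes the image
     closed. *)
  suff -> : iota @` A = C `&` range iota by exact: closedI.
  apply/seteqP; split=> [x [y Ay <-]|x [Cx [y _ yx]]].
    by split; [exact/(HC (iota y) y erefl)|exists y].
  by exists y => //; exact/(HC x y yx).
have [C cC HC] := computable_closed_preimage cY cX fun_iota ci cA.
suff -> : A = C by [].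
apply/seteqP; split=> y; first by move=> Ay; apply/(HC y _ erefl); exists y.
by move=> /(HC y _ erefl)[y' Ay' /inj <-].
Qed.

(** Limit points are carried forward by [iota] and back by its inverse, both being computable. *)
Lemma perfect_embedding (A : set Y) :
  perfect_set A <-> perfect_set (iota @` A : set X).
Proof.
have [inj ci cv] := emb.
rewrite !perfect_setP -closed_embedding; split=> -[cA lA]; split=> //.
  move=> _ [y Ay <-].
  apply: (limit_point_image cY cX fun_iota ci _ _ (lA y Ay) erefl).
    by move=> y1 y2 x -> /inj.
  by move=> y' Ay'; exists (iota y') => //; exists y'.
move=> y Ay; have iAy : (iota @` A) (iota y) by exists y.
apply: (limit_point_image cX cY fun_inv cv _ _ (lA _ iAy) erefl).
  by move=> x1 x2 y' <- <-.
by move=> _ [y' Ay' <-]; exists y'.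
Qed.

Lemma image_setD_inj (A B : set Y) :
  iota @` (A `\` B) = iota @` A `\` iota @` B.
Proof.
have [inj _ _] := emb; apply/seteqP; split=> [_ [y [Ay By] <-]|_ [[y Ay <-] By]].
  by split; [exists y|move=> [y' By' /inj yy]; apply: By; rewrite -yy].
by exists y => //; split=> // By'; apply: By; exists y.
Qed.

Lemma card_embedding (A : set Y) : (iota @` A #= A)%card.
Proof. by apply: inj_card_eq => x y _ _; case: emb => inj _ _ /inj. Qed.

Lemma perfect_kernel_embedding (A P : set Y) :
  perfect_kernel A P <-> perfect_kernel (iota @` A : set X) (iota @` P).
Proof.
have [inj _ _] := emb.
rewrite /perfect_kernel -(propext (perfect_embedding P)) -image_setD_inj.
rewrite (eq_countable (card_embedding _)).
suff -> : (iota @` P `<=` iota @` A) = (P `<=` A) by [].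
apply/propext; split=> [PA y Py|]; last exact: image_subset.
by have [|y' Ay' /inj <-//] := PA (iota y); exists y.
Qed.

Definition card_code (T : Type) (D : set T) (n : nat) : Prop :=
  (infinite_set D /\ n = 0%N) \/ (exists k : nat, (D #= `I_k)%card /\ n = k.+1).

Lemma card_code_embedding (D : set Y) n :
  card_code (iota @` D : set X) n <-> card_code D n.
Proof.
have e := card_embedding D.
rewrite /card_code (eq_finite_set e).
by split=> -[?|[k [ek ->]]]; [left| right; exists k| left| right; exists k];
  rewrite // ?(card_eql e) // -(card_eql e).
Qed.

End Embedding.

(** * The reduction *)

Lemma tc_self : total_computable (fun p => p).
Proof. by exists Oracle. Qed.

Lemma tc_join F G : total_computable F -> total_computable G ->
  total_computable (fun p => join (F p) (G p)).
Proof.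
move=> cF cG; rewrite /join; apply: tc_if; first by tcomp.
  by apply: (tc_comp cG); tcomp.
by apply: (tc_comp cF); tcomp.
Qed.

Lemma tc_evens F : total_computable F -> total_computable (fun p => evens (F p)).
Proof. by move=> cF; apply: (tc_comp cF); tcomp. Qed.

Lemma tc_odds F : total_computable F -> total_computable (fun p => odds (F p)).
Proof. by move=> cF; apply: (tc_comp cF); tcomp. Qed.

(** Complements unite, and the join lists the balls of both names alternately. *)
Lemma neg_name_setI (R : realType) (X : sepMetric R) p q (A B : set X) :
  neg_name p A -> neg_name q B -> neg_name (join p q) (A `&` B).
Proof.
move=> -> ->; rewrite /neg_name -setCU; congr (~` _).
apply/seteqP; split=> [x [] [i _ xi]|x [i _]].
- by exists i.*2 => //; rewrite -[join p q _]/(evens (join p q) i) evens_join.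
- by exists i.*2.+1 => //; rewrite -[join p q _]/(odds (join p q) i) odds_join.
by rewrite /join; case: ifP => _ xi; [right|left]; exists i./2.
Qed.

Section Solution.
Context {R : realType}.
Implicit Types X : sepMetric R.

(** The preimage under the inverse of [iota] is correct only on the range; joining a computable name
    of the range removes everything else. *)
Lemma neg_name_image (Y X : sepMetric R) (iota : cauchy_rep Y -> cauchy_rep X) :
  computable_metric Y -> computable_metric X -> computable_embedding iota ->
  Pi01 (range iota : set X) ->
  exists2 F, total_computable F & forall p (A : set Y),
    neg_name p A -> neg_name (F p) (iota @` A : set X).
Proof.
move=> cY cX [inj _ cv] [r [cr rE]].
have [F cF FE] := computable_preimage cX cY (functional_inverse inj) cv.
exists (fun p => join (F p) r) => [|p A pA].
  by apply: tc_join => //; apply: tc_seq => //; exact: tc_id.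
suff -> : iota @` A = (~` \bigcup_i @rball R X (F p i)) `&` range iota.
  exact: (@neg_name_setI R X (F p) r _ _ erefl rE).
apply/seteqP; split=> [x [y Ay <-]|x [Fx [y _ yx]]].
  by split; [exact/(FE p A pA (iota y) y erefl)|exists y].
by exists y => //; exact/(FE p A pA x y yx).
Qed.

(* [CB] names list the pair (b_i, x_i) at the positions <i, _>: the bit b_i at
   <i, 0>, and the name of x_i at the positions <i, 2k + 1>. *)
Definition bit_of (l : bseq) (i : nat) : nat := l (npair i 0).
Definition point_of (l : bseq) (i : nat) : bseq := fun k => l (npair i k.*2.+1).

Lemma seq_name_pairP X l (bx : nat -> bool * X) :
  rname (r := seq_rep (prod_rep bool_rep (cauchy_rep X))) l bx <->
  forall i, bit_of l i = (bx i).1 /\ cauchy_name (point_of l i) (bx i).2.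
Proof. by []. Qed.

Definition marked (b : nat -> nat) (v : nat -> bseq) : bseq := fun m =>
  if odd (nunpair m).2 then v (nunpair m).1 (nunpair m).2./2 else b (nunpair m).1.

Lemma marked_name X (b : nat -> bool) v (x : nat -> X) :
  (forall i, cauchy_name (v i) (x i)) ->
  rname (r := seq_rep (prod_rep bool_rep (cauchy_rep X))) (marked b v)
    (fun i => (b i, x i)).
Proof.
move=> vx; apply/seq_name_pairP => i; rewrite /bit_of /marked npairK /=.
suff -> : point_of (marked b v) i = v i by split=> //; exact: vx.
apply/funext => k.
by rewrite /point_of /marked npairK /= odd_double /= uphalf_double.
Qed.

(* Where b_i = 0 the point x_i may lie outside the domain of the map computed
   by [c], so that running [c] on its name could diverge. *)
Lemma marked_computable F c : total_computable F ->
  exists Psi, forall p q (b : nat -> bool) (v : nat -> bseq),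
    let l := odds (odds q) in
    (forall i, bit_of l i = b i) ->
    (forall i, if b i then computes c (point_of l i) (v i) else v i = fun=> 0%N) ->
    computes Psi (join p q)
      (join (F (evens q)) (join (evens (odds q)) (marked b v))).
Proof.
move=> cF.
pose L (u : bseq) := odds (odds (odds u)).
have cL : total_computable L by exact: (tc_odds (tc_odds (tc_odds tc_self))).
(* Halving twice undoes the two joins: [i_] is the index of the listed point, [k_] the position
   within its entry. *)
pose i_ m := (nunpair m./2./2).1; pose k_ m := (nunpair m./2./2).2.
pose T u m : bool :=
  [&& odd m, odd m./2, odd (k_ m) & odd (bit_of (L u) (i_ m))].
have [t Tt] : decidable_in T.
  rewrite /T /bit_of /i_ /k_; repeat tc_head; try exact: tc_id.
    by apply: tc_snd; tcomp.
  by apply: (tc_comp cL); tcomp.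
(* The default output is total: it is already correct except at the values of marked points, where
   it puts 0. *)
have [d Dd] : total_computable (fun u => join (F (evens (odds u)))
    (join (evens (odds (odds u))) (marked (bit_of (L u)) (fun _ _ => 0%N)))).
  apply: tc_join.
    exact: tc_subst cF (tc_evens (tc_odds tc_self)).
  apply: tc_join; first exact: (tc_evens (tc_odds (tc_odds tc_self))).
  rewrite /marked /bit_of; apply: tc_if; [by tcomp|exact: tc_const|].
  by apply: (tc_comp cL); tcomp.
have [getp Gp] : total_computable (fun u m => point_of (L u) (nunpair m).1 (nunpair m).2).
  by apply: (tc_comp cL); tcomp.
have [a Aa] : total_computable (fun _ m => npair (i_ m) (k_ m)./2).
  by rewrite /i_ /k_; tcomp.
exists (guard t d (Comp (subst getp c) a)) => p q b v l lb lv n.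
have LE : L (join p q) = l by rewrite /L odds_join.
have -> : join (F (evens q)) (join (evens (odds q)) (marked b v)) n =
    if T (join p q) n then v (i_ n) (k_ n)./2 else
    join (F (evens q))
      (join (evens (odds q)) (marked (bit_of l) (fun _ _ => 0%N))) n.
  rewrite /T LE lb oddb /join /marked -/(i_ n) -/(k_ n) lb.
  case: (odd n) => //=; case: (odd n./2) => //=; case: (odd (k_ n)) => //=.
  by case: (b (i_ n)) (lv (i_ n)) => //= ->.
apply: eval_guard.
- exact: Tt.
- by have := Dd (join p q) n; rewrite odds_join LE.
rewrite /T LE lb oddb => /and4P[_ _ _ bi].
exists (npair (i_ n) (k_ n)./2); first exact: Aa.
apply: (eval_subst (r := point_of l (i_ n))) => [k|].
  by have := Gp (join p q) (npair (i_ n) k); rewrite LE npairK.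
by have := lv (i_ n); rewrite bi; exact.
Qed.

Lemma cauchy_name_const X (n : nat) : cauchy_name (fun=> n) (spt X n).
Proof. by apply: fast_cauchy_name => j; rewrite mdistxx half_pow_gt0. Qed.

End Solution.

Theorem theorem5p28 (R : realType) (X : sepMetric R) :
  computable_Polish X -> rich X -> computably_non_Ksigma X ->
  weihrauch_le (CB (baire R)) (CB X).
Proof.
move=> [cX _] _ [iota [emb rg]]; have cB := computable_baire R.
have [inj ci cv] := emb.
have cl : closed (range iota : set X) by have [r [_ /neg_name_closed]] := rg.
have [G [Phi cG] GE] := neg_name_image cB cX emb rg.
have [F cF FE] := computable_preimage cB cX (functional_fun (f := iota)) ci.
have [c cc] := cv.
have [Psi cPsi] := marked_computable c cF.
exists Phi, Psi => p [A cA] pA [[[P cP] [n bx]] [/= kerP DE nE]].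
have cA' : closed (iota @` A : set X) by apply/(closed_embedding cB cX emb cl).
have cP' : closed (iota @` P : set X) by apply/(closed_embedding cB cX emb cl).
exists (G p), (exist _ _ cA'); split; [exact: cG|exact: GE| |].
  (* The instance lies in the domain of [CB X], because a solution for [A] is carried to one for its
     image. *)
  exists (exist _ _ cP', (n, fun i => ((bx i).1, iota (bx i).2))).
  split=> /=.
  - exact/(perfect_kernel_embedding cB cX emb cl).
  - rewrite -(image_setD_inj emb) DE; apply/seteqP; split=> x.
      by move=> [y [i bxi] <-]; exists i; rewrite bxi.
    move=> [i [bi <-]]; exists (bx i).2 => //; exists i.
    by rewrite -bi -surjective_pairing.
  - by rewrite -(image_setD_inj emb); exact/(card_code_embedding emb).
move=> q [[P' cP''] [m bz]] [/= kerP' DE' mE] [/= qP' [/= qm /seq_name_pairP qbz]].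
set l := odds (odds q) in qbz.
(* Marked points lie in the image of [A], hence in the domain of the inverse of [iota]. *)
have marked_in i : (bz i).1 -> (iota @` A `\` P') (bz i).2.
  by move=> bi; rewrite DE'; exists i; rewrite -bi -surjective_pairing.
have /choice[vy vyP] i : exists vy : bseq * baire R,
    [/\ if (bz i).1 then computes c (point_of l i) vy.1 else vy.1 = (fun=> 0%N),
        cauchy_name vy.1 vy.2 & (bz i).1 -> iota vy.2 = (bz i).2].
  case bi: (bz i).1; last first.
    (* The zero sequence written at unmarked entries still has to name a point, here the 0-th dense
       one. *)
    by exists (fun=> 0%N, spt (baire R) 0%N); split=> //; exact: cauchy_name_const.
  have [[y _ yi] _] := marked_in i bi.
  have [|v [y' [cv' vy' y'i]]] := cc (point_of l i) (bz i).2 (qbz i).2.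
    by exists y.
  by exists (v, y').
(* As [P'] lies within the range, it is the image of its preimage [P0], and the transfer lemmas
   apply to [P0]. *)
pose P0 : set (baire R) := iota @^-1` P'.
have P0E : iota @` P0 = P'.
  apply/seteqP; split=> [_ [y P0y <-]//|x P'x].
  by have [_ sub _] := kerP'; have [y _ yx] := sub x P'x; exists y; rewrite /P0 /= ?yx.
have qP0 : neg_name (F (evens q)) P0.
  apply/esym/seteqP; split=> y; first by move=> /(FE _ _ qP' _ _ erefl).
  by move=> P0y; apply/(FE _ _ qP' _ _ erefl).
have cP0 := neg_name_closed qP0.
exists (join (F (evens q)) (join (evens (odds q))
  (marked (fun i => (bz i).1) (fun i => (vy i).1)))).
exists (exist _ _ cP0, (m, fun i => ((bz i).1, (vy i).2))).
split.
- apply: cPsi => i; first by have [] := qbz i.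
  by have [] := vyP i.
- split; rewrite ?evens_join ?odds_join //=; split; rewrite ?evens_join ?odds_join //=.
  by apply: (marked_name (fun i => (bz i).1)) => i; have [] := vyP i.
rewrite -P0E -(image_setD_inj emb) in kerP' DE' mE.
split=> /=.
- exact/(perfect_kernel_embedding cB cX emb cl).
- apply/seteqP; split=> y.
    move=> Dy; have : (iota @` (A `\` P0)) (iota y) by exists y.
    rewrite DE' => -[i bzi]; exists i; have [_ _] := vyP i.
    by rewrite bzi /= => /(_ isT) /inj ->.
  move=> [i [bi <-]]; have [_ _ /(_ bi) yi] := vyP i.
  have : (iota @` (A `\` P0)) (bz i).2.
    by rewrite DE'; exists i; rewrite -bi -surjective_pairing.
  by rewrite -yi => -[y' Dy' /inj <-].
- exact/(card_code_embedding emb).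
Qed.
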